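(* Let $G$ be a finite digraph with vertex set $V$ and let $R=J_G:V\times V\to 2^V$ be defined by $J_G(u,v)=\{x\in V\mid x \text{ lies on a shortcut-free path from } u \text{ to } v \text{ in } G\}$. Then $R$ satisfies, for all $u,v,x,y\in V$: (j2) if $R(u,x)=\{u,x\}$, $R(x,v)=\{x,v\}$ and $R(u,v)\neq\{u,v\}$, then $x\in R(u,v)$; (j2') if $x\in R(u,y)$, $y\in R(x,v)$, $R(u,x)=\{u,x\}$, $R(x,y)=\{x,y\}$, $R(y,v)=\{y,v\}$ and $R(u,v)\neq\{u,v\}$, then $x\in R(u,v)$.
   Context: Digraphs are finite, loopless and simple. A directed path from $u$ to $v$ is a sequence $(x_0=u,x_1,\dots,x_n=v)$ of pairwise distinct vertices with each $(x_{i-1},x_i)$ an edge; $n=0$ (a single vertex, $u=v$) is allowed. A directed path $(x_0,x_1,\dots,x_n)$ in $G$ is shortcut-free if there is no edge $(x_i,x_j)\in E(G)$ with $j>i+1$ (backward edges $(x_i,x_j)$ with $j<i$ are allowed). *)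

(* Defs.v *)
From mathcomp Require Import all_boot.

Set Implicit Arguments.
Unset Strict Implicit.
Unset Printing Implicit Defensive.

(* A finite loopless simple digraph is an irreflexive relation e on a finType;
   irreflexivity is a hypothesis of the theorems, not of the definitions. *)
Section ShortcutFree.

Variables (V : finType) (e : rel V).
Implicit Types (u v x : V) (p s : seq V).

(* The vertices of the path are x_0 = u followed by p = [:: x_1; ...; x_n]. *)
Definition directed_path u v p : bool :=
  [&& path e u p, last u p == v & uniq (u :: p)].

Definition shortcut_free s : bool :=
  [forall i : 'I_(size s), forall j : 'I_(size s),
     (i.+1 < j) ==> ~~ e (tnth (in_tuple s) i) (tnth (in_tuple s) j)].

Definition sf_path u v p : bool := directed_path u v p && shortcut_free (u :: p).

(* The bound n < #|V| only makes the quantification over paths finite: the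
   vertices u :: p of a directed path are distinct (see mem_J). *)
Definition J u v : {set V} :=
  [set x | [exists n : 'I_#|V|, exists p : n.-tuple V,
              sf_path u v p && (x \in u :: p)]].

Lemma mem_J u v x :
  reflect (exists2 p, sf_path u v p & x \in u :: p) (x \in J u v).
Proof.
rewrite inE; apply: (iffP existsP) => [[n /existsP[p /andP[hp xp]]]|[p hp xp]].
  by exists p.
have hn : size p < #|V|.
  case/andP: hp => /and3P[_ _ /card_uniqP hu] _.
  by rewrite -[_.+1]/(size (u :: p)) -hu max_card.
by exists (Ordinal hn); apply/existsP; exists (in_tuple p); rewrite /= hp.
Qed.

Lemma shortcut_freeP x0 s :
  reflect (forall i j, i.+1 < j -> j < size s -> ~~ e (nth x0 s i) (nth x0 s j))
          (shortcut_free s).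
Proof.
apply: (iffP forallP) => [h i j ij js|h i].
  have is_ : i < size s by apply: leq_trans js; apply: ltnW; apply: ltnW.
  have /forallP/(_ (Ordinal js))/implyP/(_ ij) := h (Ordinal is_).
  by rewrite !(tnth_nth x0).
by apply/forallP=> j; apply/implyP=> ij; rewrite !(tnth_nth x0) h.
Qed.

End ShortcutFree.

(* Main.v *)
(* [J u v = {u, v}] holds exactly when [u = v] or [(u, v)] is an edge. Under
   the hypotheses of (j2) this makes [(u, x, v)] a path, shortcut-free because
   [(u, v)] is not an edge. In (j2'), if two consecutive vertices of
   [(u, x, y, v)] coincide then (j2) applies; otherwise [x \in J u y] and
   [y \in J x v] exclude the remaining coincidences and the shortcuts [(u, y)]
   and [(x, v)], so [(u, x, y, v)] is a shortcut-free path. *)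
Require Import Defs.
From mathcomp Require Import all_boot.

Set Implicit Arguments.
Unset Strict Implicit.

Section Intervals.

Variables (V : finType) (e : rel V).
Implicit Types (u v x y : V) (p : seq V).

(** An edge [(u, v)] would itself be a shortcut from first to last vertex of any longer path, and a
    closed path with distinct vertices is trivial. *)
Lemma sf_path_edge u v p :
  (u == v) || e u v -> sf_path e u v p -> u :: p =i [set u; v].
Proof.
move=> uv /andP[/and3P[_ /eqP lp up] /(shortcut_freeP _ u) sf].
case/orP: uv => [/eqP uv|uv] z; last first.
  have sp : size p <= 1.
    rewrite leqNgt; apply/negP=> p_gt1.
    have := sf 0 (size p) p_gt1 (leqnn _).
    by rewrite (nth_last u (u :: p)) /= lp uv.
  by case: p lp sp {sf up} => [|w [|]] //= <- _; rewrite !inE ?orbb.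
case: p lp up {sf} => [|w p] lp; first by rewrite -uv !inE orbb.
(* Here [u] equals the last vertex of [w :: p], so it recurs in its own tail. *)
by rewrite cons_uniq -[X in X \notin _](etrans lp (esym uv)) /= mem_last.
Qed.

Lemma J_edge u v : (J e u v == [set u; v]) = (u == v) || e u v.
Proof.
apply/eqP/idP=> [Juv|uv].
  (* Membership of [u] guarantees that some shortcut-free path exists; its second vertex differs
     from [u], hence is [v]. *)
  have /mem_J[p pP _] : u \in J e u v by rewrite Juv set21.
  have sub z : z \in u :: p -> z \in [set u; v].
    by move=> zp; rewrite -Juv; apply/mem_J; exists p.
  case/andP: pP => /and3P[ep /eqP lp up] _.
  case: p ep lp up sub => [|w p] /=; first by move=> _ ->; rewrite eqxx.
  case/andP=> euw _ _ /andP[]; rewrite inE negb_or => /andP[uw _] _ sub.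
  have := sub w; rewrite !inE eqxx orbT eq_sym (negPf uw) => /(_ isT) /eqP <-.
  by rewrite euw orbT.
apply/setP=> z; apply/mem_J/idP=> [[p pP zp]|zuv].
  by rewrite -(sf_path_edge uv pP).
have [uv0|nuv] := eqVneq u v.
  exists [::]; last by move: zuv; rewrite -uv0 !inE orbb.
  rewrite /sf_path /directed_path /= uv0 eqxx /=.
  by apply/(shortcut_freeP _ u) => [] [|i] [|j].
exists [:: v]; last by move: zuv; rewrite !inE.
move: uv; rewrite (negPf nuv) /= => uv.
rewrite /sf_path /directed_path /= uv eqxx inE nuv /=.
by apply/(shortcut_freeP _ u) => [] [|i] [|[|j]].
Qed.

Lemma mem_J_edge u v z :
  (u == v) || e u v -> z \in J e u v -> (z == u) || (z == v).
Proof. by rewrite -J_edge => /eqP->; rewrite !inE. Qed.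

Lemma mem_J_source u v z : z \in J e u v -> u \in J e u v.
Proof. by case/mem_J=> p pP _; apply/mem_J; exists p; rewrite ?mem_head. Qed.

Lemma J_j2 u v x :
  J e u x = [set u; x] -> J e x v = [set x; v] -> J e u v <> [set u; v] ->
  x \in J e u v.
Proof.
move=> Jux Jxv /eqP Juv.
(* If [x] is [u] or [v], one of the first two hypotheses contradicts the third. *)
have [xu|nux] := eqVneq u x; first by rewrite xu Jxv eqxx in Juv.
have [xv|nxv] := eqVneq x v; first by rewrite -xv Jux eqxx in Juv.
move/eqP: Jux Juv; move/eqP: Jxv; rewrite !J_edge (negPf nux) (negPf nxv) /=.
move=> exv eux; rewrite negb_or => /andP[nuv neuv].
apply/mem_J; exists [:: x; v]; last by rewrite !inE eqxx orbT.
rewrite /sf_path /directed_path /= eux exv eqxx !inE negb_or nux nuv nxv /=.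
by apply/(shortcut_freeP _ u) => [] [|i] [|[|[|j]]].
Qed.

Lemma J_j2' u v x y :
  x \in J e u y -> y \in J e x v ->
  J e u x = [set u; x] -> J e x y = [set x; y] -> J e y v = [set y; v] ->
  J e u v <> [set u; v] -> x \in J e u v.
Proof.
move=> xuy yxv Jux Jxy Jyv Juv.
have [ux|nux] := eqVneq u x.
  (* With [x = u], (j2) through [y] puts [y] in [J e u v], which is thus nonempty and contains its
     source. *)
  by subst x; apply: (@mem_J_source _ _ y); apply: J_j2.
have [xy|nxy] := eqVneq x y; first by subst y; apply: J_j2.
have [yv|nyv] := eqVneq y v; first by subst v; apply: J_j2.
have : ~~ ((u == y) || e u y).
  by apply: contraL xuy => /mem_J_edge h; apply/negP=> /h;
     rewrite eq_sym (negPf nux) (negPf nxy).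
have : ~~ ((x == v) || e x v).
  by apply: contraL yxv => /mem_J_edge h; apply/negP=> /h;
     rewrite eq_sym (negPf nxy) (negPf nyv).
move/eqP: Juv; move/eqP: Jux; move/eqP: Jxy; move/eqP: Jyv.
rewrite !J_edge (negPf nux) (negPf nxy) (negPf nyv) /= !negb_or.
move=> eyv exy eux /andP[nuv neuv] /andP[nxv nexv] /andP[nuy neuy].
apply/mem_J; exists [:: x; y; v]; last by rewrite !inE eqxx orbT.
rewrite /sf_path /directed_path /= eux exy eyv eqxx !inE !negb_or.
rewrite nux nuy nuv nxy nxv nyv /=.
(* Only the index pairs (0,2), (0,3), (1,3) satisfy the bounds; they are the non-edges [(u, y)],
   [(u, v)], [(x, v)]. *)
by apply/(shortcut_freeP _ u) => [] [|[|i]] [|[|[|[|j]]]].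
Qed.

End Intervals.

Theorem lemma38 (V : finType) (G : rel V) (loopless : irreflexive G) :
  let R := J G in
  forall u v x y : V,
    (R u x = [set u; x] -> R x v = [set x; v] -> R u v <> [set u; v] ->
     x \in R u v)
    /\
    (x \in R u y -> y \in R x v ->
     R u x = [set u; x] -> R x y = [set x; y] -> R y v = [set y; v] ->
     R u v <> [set u; v] ->
     x \in R u v).
Proof. by move=> R u v x y; split; [apply: J_j2 | apply: J_j2']. Qed.
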